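(* Let $w\in S_n$. The Schubert determinantal ideal $I_w$ is binomial if and only if $w$ avoids the patterns $1243$ and $2143$.
   Context: $\Bbbk$ is a field and $R=\Bbbk[x_{ij}]_{1\le i,j\le n}$. For $w\in S_n$, the permutation matrix $M_w$ has $1$s in positions $(i,w(i))$ and $0$s elsewhere. The rank function $r_w(i,j)$ counts the $1$s of $M_w$ weakly northwest of $(i,j)$, i.e. $r_w(i,j)=\#\{k\le i: w(k)\le j\}$. Let $M^{[a,b]}$ be the northwest $a\times b$ submatrix of the generic matrix $[x_{ij}]_{1\le i,j\le n}$. The Schubert determinantal ideal (the defining ideal of the matrix Schubert variety of $w$) is $$I_w=\langle (r_w(i,j)+1)\times(r_w(i,j)+1)\text{ minors of }M^{[i,j]} : 1\le i,j\le n\rangle\subseteq R.$$ An ideal is binomial if it can be generated by binomials, where a binomial is a polynomial with at most two terms (so monomials are allowed). A permutation $w\in S_n$ contains a pattern $v\in S_m$ if there are indices $i_1<\dots<i_m$ such that $w(i_1),\dots,w(i_m)$ are in the same relative order as $v(1),\dots,v(m)$; otherwise $w$ avoids $v$. *)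

(* Defs.v *)
From HB Require Import structures.
From mathcomp Require Import all_boot all_fingroup all_algebra.
From mathcomp Require Import mpoly.

Set Implicit Arguments.
Unset Strict Implicit.
Unset Printing Implicit Defensive.

Import GRing.Theory.

Local Open Scope ring_scope.

(* Indices are 0-based throughout: [i : 'I_n] stands for the 1-based index
   [i.+1], and [w : 'S_n] for the permutation of {1, ..., n} sending [i.+1]
   to [(w i).+1]. *)

Definition ideal_gen (R : comNzRingType) (G : R -> Prop) (p : R) : Prop :=
  exists2 s : seq (R * R),
    (forall t, t \in s -> G t.2) & p = \sum_(t <- s) t.1 * t.2.

(* The variable x_ij is ['X_(mxvec_index i j)], through the bijection
   [mxvec_index] between pairs of indices and ['I_(n * n)]. *)
Definition generic_mx (k : fieldType) (n : nat) : 'M[{mpoly k[n * n]}]_n :=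
  \matrix_(i, j) 'X_(mxvec_index i j).

Definition nw_submx (T : Type) (n : nat) (A : 'M[T]_n) (i j : 'I_n) :
    'M[T]_(i.+1, j.+1) :=
  mxsub (widen_ord (ltn_ord i)) (widen_ord (ltn_ord j)) A.

(* There is no minor of size [s] when [s] exceeds one of the dimensions. *)
Definition is_minor (R : comNzRingType) (s a b : nat) (A : 'M[R]_(a, b))
    (p : R) : Prop :=
  exists (f : 'I_s -> 'I_a) (g : 'I_s -> 'I_b),
    [/\ {homo f : x y / (x < y)%N}, {homo g : x y / (x < y)%N}
      & p = \det (mxsub f g A)].

Definition rank_fun (n : nat) (w : 'S_n) (i j : 'I_n) : nat :=
  #|[set l : 'I_n | (l <= i)%N && (w l <= j)%N]|.

Definition schubert_ideal (k : fieldType) (n : nat) (w : 'S_n) :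
    {mpoly k[n * n]} -> Prop :=
  ideal_gen (fun p => exists i j : 'I_n,
    is_minor (rank_fun w i j).+1 (nw_submx (generic_mx k n) i j) p).
Arguments schubert_ideal k {n} w _.

Definition is_binomial (k : fieldType) (m : nat) (p : {mpoly k[m]}) : Prop :=
  (size (msupp p) <= 2)%N.

Definition binomial_ideal (k : fieldType) (m : nat)
    (I : {mpoly k[m]} -> Prop) : Prop :=
  exists2 B : {mpoly k[m]} -> Prop,
    (forall b, B b -> is_binomial b) & (forall p, I p <-> ideal_gen B p).

Definition contains_pattern (n m : nat) (w : 'S_n) (v : 'S_m) : Prop :=
  exists2 f : 'I_m -> 'I_n, {homo f : a b / (a < b)%N}
    & forall a b : 'I_m, (w (f a) < w (f b))%N = (v a < v b)%N.

Definition avoids (n m : nat) (w : 'S_n) (v : 'S_m) : Prop :=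
  ~ contains_pattern w v.

Definition perm1243 : 'S_4 := tperm (inord 2) (inord 3).
Definition perm2143 : 'S_4 :=
  (tperm (inord 0) (inord 1) * tperm (inord 2) (inord 3))%g.

Lemma perm1243_oneline (i : 'I_4) :
  (perm1243 i).+1 = nth 0%N [:: 1; 2; 4; 3]%N i.
Proof.
rewrite /perm1243 permE /= -!val_eqE /= !inordK //.
by case: i => [[|[|[|[|]]]]] //= _; rewrite ?inordK.
Qed.

Lemma perm2143_oneline (i : 'I_4) :
  (perm2143 i).+1 = nth 0%N [:: 2; 1; 4; 3]%N i.
Proof.
rewrite /perm2143 permM !permE /= -!val_eqE /= !inordK //.
by case: i => [[|[|[|[|]]]]] //= _; rewrite ?inordK //= ?inordK.
Qed.

(* Main.v *)
Require Import Defs.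
From mathcomp Require Import all_boot all_fingroup all_algebra.
From mathcomp Require Import mpoly.
From mathcomp Require Import zify.
From Stdlib Require Import Classical ClassicalEpsilon.

(* Avoiding 1243 and 2143 means that every box of the diagram of [w] has rank at
   most 1. In that case Laplace expansion reduces all the defining minors to the
   minors of size at most 2 attached to the boxes, and these are binomials.
   Conversely, suppose that the box [(i, j)] has the 1s of rows [q1 <> q2] of the
   permutation matrix strictly northwest of it. The minor on the rows and columns
   of all the 1s northwest of the box, together with row [i] and column [j], has a
   term formed by these 1s and the entry [(i, j)]. For [q = q1, q2], adding row [q]
   to row [i] and column [w q] to column [j] in the permutation matrix gives a
   point of the matrix Schubert variety where this term is 1; any other term
   vanishes at one of the two points. Hence no binomial of the ideal relates this
   term to another one, whereas an ideal generated by binomials would need one. *)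

Set Implicit Arguments.
Unset Strict Implicit.
Unset Printing Implicit Defensive.

Import GRing.Theory.

Local Open Scope ring_scope.

(** * Ideals given by generators *)

Lemma ideal_gen_sub (R : comNzRingType) (G : R -> Prop) (p : R) :
  G p -> ideal_gen G p.
Proof.
move=> Gp; exists [:: (1, p)]; last by rewrite big_seq1 mul1r.
by move=> t; rewrite inE => /eqP->.
Qed.

Lemma ideal_gen0 (R : comNzRingType) (G : R -> Prop) : ideal_gen G 0.
Proof. by exists [::] => //; rewrite big_nil. Qed.

Lemma ideal_genD (R : comNzRingType) (G : R -> Prop) (p q : R) :
  ideal_gen G p -> ideal_gen G q -> ideal_gen G (p + q).
Proof.
move=> [s Gs ->] [t Gt ->]; exists (s ++ t); last by rewrite big_cat.
by move=> u; rewrite mem_cat => /orP[/Gs|/Gt].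
Qed.

Lemma ideal_genM (R : comNzRingType) (G : R -> Prop) (c p : R) :
  ideal_gen G p -> ideal_gen G (c * p).
Proof.
move=> [s Gs ->]; exists [seq (c * t.1, t.2) | t <- s].
  by move=> _ /mapP[t /Gs Gt ->].
by rewrite big_map mulr_sumr; apply: eq_bigr => t _; rewrite mulrA.
Qed.

Lemma ideal_gen_sum (R : comNzRingType) (G : R -> Prop) (T : Type)
    (s : seq T) (F : T -> R) :
  (forall t, ideal_gen G (F t)) -> ideal_gen G (\sum_(t <- s) F t).
Proof.
move=> GF; elim: s => [|t s IHs]; first by rewrite big_nil; apply: ideal_gen0.
by rewrite big_cons; apply: ideal_genD.
Qed.

Lemma ideal_gen_min (R : comNzRingType) (G H : R -> Prop) :
  (forall g, G g -> ideal_gen H g) ->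
  forall p, ideal_gen G p -> ideal_gen H p.
Proof.
move=> GH p [s Gs ->]; elim: s Gs => [|t s IHs] Gs.
  by rewrite big_nil; apply: ideal_gen0.
rewrite big_cons; apply: ideal_genD.
  by apply/ideal_genM/GH/Gs; rewrite mem_head.
by apply: IHs => u us; apply: Gs; rewrite in_cons us orbT.
Qed.

Lemma ideal_genZ (k : fieldType) (m : nat) (G : {mpoly k[m]} -> Prop)
    (c : k) (p : {mpoly k[m]}) :
  ideal_gen G p -> ideal_gen G (c *: p).
Proof. by rewrite -mul_mpolyC; apply: ideal_genM. Qed.

(** * Linear forms prescribed on monomials, and binomial ideals *)

Section MonomialForm.

Variables (k : fieldType) (m : nat) (phi : 'X_{1..m} -> k).

Definition monomial_form (p : {mpoly k[m]}) : k :=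
  \sum_(u <- msupp p) p@_u * phi u.

Lemma monomial_form_seq (s : seq 'X_{1..m}) (p : {mpoly k[m]}) :
  uniq s -> {subset msupp p <= s} ->
  monomial_form p = \sum_(u <- s) p@_u * phi u.
Proof.
move=> us sub; rewrite [RHS](bigID (fun u => u \in msupp p)) /=.
rewrite [X in _ + X]big1 => [|u /memN_msupp_eq0->]; last by rewrite mul0r.
rewrite addr0 -big_filter; apply/perm_big/uniq_perm.
- exact: msupp_uniq.
- exact: filter_uniq.
by move=> u; rewrite mem_filter andb_idr // => /sub.
Qed.

Lemma monomial_formD : {morph monomial_form : p q / p + q}.
Proof.
move=> p q; pose s := undup (msupp p ++ msupp q).
have us : uniq s by apply: undup_uniq.
rewrite !(monomial_form_seq us).
- by rewrite -big_split; apply: eq_bigr => u _; rewrite mcoeffD mulrDl.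
- by move=> u uq; rewrite mem_undup mem_cat uq orbT.
- by move=> u up; rewrite mem_undup mem_cat up.
- by move=> u /msuppD_le; rewrite mem_undup.
Qed.

Lemma monomial_form0 : monomial_form 0 = 0.
Proof. by rewrite /monomial_form msupp0 big_nil. Qed.

Lemma monomial_formZX (c : k) (u : 'X_{1..m}) :
  monomial_form (c *: 'X_[u]) = c * phi u.
Proof.
rewrite (@monomial_form_seq [:: u]) //.
  by rewrite big_seq1 mcoeffZ mcoeffX eqxx mulr1.
by move=> v /msuppZ_le; rewrite msuppX.
Qed.

Lemma monomial_form_sum (T : Type) (s : seq T) (F : T -> {mpoly k[m]}) :
  monomial_form (\sum_(t <- s) F t) = \sum_(t <- s) monomial_form (F t).
Proof. exact: (big_morph _ monomial_formD monomial_form0). Qed.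

Lemma monomial_formMX (u : 'X_{1..m}) (p : {mpoly k[m]}) :
  monomial_form ('X_[u] * p) = \sum_(v <- msupp p) p@_v * phi (u + v)%MM.
Proof.
rewrite {1}[p]mpolyE mulr_sumr monomial_form_sum.
by under eq_bigr => v _ do rewrite -scalerAr -mpolyXD monomial_formZX.
Qed.

(** Monomial multiples of elements of [B] span the ideal over [k], so a linear form need only be
    tested on them. *)
Lemma monomial_form_ideal (B : {mpoly k[m]} -> Prop) (p : {mpoly k[m]}) :
  (forall b u, B b -> monomial_form ('X_[u] * b) = 0) ->
  ideal_gen B p -> monomial_form p = 0.
Proof.
move=> B0 [s Bs ->]; rewrite monomial_form_sum big_seq big1 // => -[q b] /Bs /= Bb.
rewrite [X in X * _]mpolyE mulr_suml monomial_form_sum big1 // => u _.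
rewrite -scalerAl; have := B0 b u Bb.
rewrite monomial_formMX => B0u; rewrite [b in _ * b]mpolyE mulr_sumr.
rewrite scaler_sumr monomial_form_sum.
have := congr1 (fun x => q@_u * x) B0u; rewrite mulr0 mulr_sumr; apply: etrans.
apply: eq_bigr => v _.
by rewrite -scalerAr scalerA -mpolyXD monomial_formZX mulrA.
Qed.

End MonomialForm.

(* Modulo an ideal with binomial generators, the nonzero monomials are linearly
   independent up to proportionality: reading off the multiple of ['X_[M t0]]
   that each monomial is congruent to gives a linear form killing the ideal. *)
Lemma binomial_ideal_monomials (k : fieldType) (m : nat)
    (G : {mpoly k[m]} -> Prop) (T : finType) (c : T -> k)
    (M : T -> 'X_{1..m}) (t0 : T) :
    binomial_ideal (ideal_gen G) ->
    ideal_gen G (\sum_t c t *: 'X_[M t]) -> c t0 != 0 ->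
    ~ ideal_gen G 'X_[M t0] ->
  exists2 t, t != t0 &
    exists2 a, a != 0 & ideal_gen G ('X_[M t] - a *: 'X_[M t0]).
Proof.
move=> [B binB GB] Gp ct0 GNt0; apply: NNPP => noT.
pose cong u a := ideal_gen G ('X_[u] - a *: 'X_[M t0]).
pose P u a := cong u a \/ (~ exists b, cong u b) /\ a = 0.
(* [phi u] is the multiple of ['X_[M t0]] that ['X_[u]] is congruent to, and 0 if there is none. *)
pose phi u := epsilon (inhabits 0) (P u).
have phiP u : cong u (phi u) \/ (~ exists b, cong u b) /\ phi u = 0.
  apply: (epsilon_spec _ (P u)); have [[a ua]|nu] := classic (exists b, cong u b).
    by exists a; left.
  by exists 0; right.
(* The multiple is unique because ['X_[M t0]] is not in the ideal. *)
have uniqG a b : ideal_gen G (a *: 'X_[M t0] - b *: 'X_[M t0]) -> a = b.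
  rewrite -scalerBl => Gab; apply/eqP; rewrite -subr_eq0; apply/negP=> ab.
  case: GNt0; have := ideal_genZ (a - b)^-1 Gab.
  by rewrite scalerA mulVf ?scale1r //; apply/negP.
have congE u a : cong u a -> phi u = a.
  move=> ua; have [uphi|[[]]] := phiP u; last by exists a.
  apply: uniqG; have := ideal_genD ua (ideal_genZ (-1) uphi).
  rewrite !scaleN1r opprB [X in ideal_gen G X]addrC addrA subrK.
  exact.
have cong_lin (a b : k) u v (x : k) : a != 0 ->
    ideal_gen G (a *: 'X_[u] + b *: 'X_[v]) -> cong v x -> cong u (- (b / a) * x).
  move=> a0 Gab vx; have := ideal_genD (ideal_genZ a^-1 Gab) (ideal_genZ (- (b / a)) vx).
  rewrite /cong scalerDr scalerBr !scalerA mulVf // scale1r !scaleNr mulrC.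
  by rewrite addrA addrK.
(* A two-term relation carries a congruence from either monomial to the other; if neither has one,
   both values are 0. *)
have phi_bin (a b : k) u v : a != 0 -> b != 0 ->
    ideal_gen G (a *: 'X_[u] + b *: 'X_[v]) -> a * phi u + b * phi v = 0.
  move=> a0 b0 Gab; have [vc|[nv ->]] := phiP v.
    rewrite (congE _ _ (cong_lin _ _ _ _ _ a0 Gab vc)).
    by rewrite mulrA mulrN mulrCA divff // mulr1 mulNr addNr.
  have [uc|[nu ->]] := phiP u; last by rewrite !mulr0 addr0.
  case: nv; exists (- (a / b) * phi u).
  by apply: cong_lin uc => //; rewrite addrC.
have phi_mon (a : k) u : a != 0 -> ideal_gen G (a *: 'X_[u]) -> phi u = 0.
  move=> a0 Ga; apply: congE; rewrite /cong scale0r subr0.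
  by have := ideal_genZ a^-1 Ga; rewrite scalerA mulVf // scale1r.
(* [phi] is 1 at [M t0], and by [noT] it vanishes at every other [M t]. So the form does not kill an
   element of the ideal, and the contradiction comes from showing that it must. *)
have form_p : monomial_form phi (\sum_t c t *: 'X_[M t]) = c t0.
  rewrite monomial_form_sum (bigD1 t0) //= monomial_formZX (congE _ 1).
    rewrite mulr1 big1 ?addr0 // => t tt0; rewrite monomial_formZX.
    have [tc|[_ ->]] := phiP (M t); last by rewrite mulr0.
    have [->|phi0] := eqVneq (phi (M t)) 0; first by rewrite mulr0.
    by case: noT; exists t => //; exists (phi (M t)).
  by rewrite /cong scale1r subrr; apply: ideal_gen0.
move/eqP: ct0; apply; rewrite -form_p.
apply: (@monomial_form_ideal _ _ _ B); last by apply/GB.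
move=> b u Bb.
have Gub : ideal_gen G (\sum_(v <- msupp b) b@_v *: 'X_[(u + v)%MM]).
  under eq_bigr => v _ do rewrite mpolyXD scalerAr.
  by rewrite -mulr_sumr -mpolyE; apply/ideal_genM/GB/ideal_gen_sub.
have nzb v : v \in msupp b -> b@_v != 0 by rewrite mcoeff_eq0 negbK.
rewrite monomial_formMX; move: (binB b Bb) Gub nzb; rewrite /is_binomial.
case: (msupp b) => [|v [|v' [|]]] //= _ Gub nz.
- by rewrite big_nil.
- move: Gub; rewrite !big_seq1 => Gv.
  by rewrite (phi_mon b@_v) ?mulr0 // nz ?mem_head.
move: Gub; rewrite !big_cons !big_nil !addr0.
by apply: phi_bin; rewrite nz ?inE ?eqxx ?orbT.
Qed.

(** * Reduction of minors to diagram boxes by Laplace expansion *)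

Lemma is_minor_nwP (R : comNzRingType) (n s : nat) (A : 'M[R]_n)
    (i j : 'I_n) (p : R) :
  is_minor s (nw_submx A i j) p <->
  exists f g : 'I_s -> 'I_n,
    [/\ {homo f : x y / (x < y)%N}, {homo g : x y / (x < y)%N},
        forall x, (f x <= i)%N, forall x, (g x <= j)%N
      & p = \det (mxsub f g A)].
Proof.
split=> [[f [g [fI gI ->]]]|[f [g [fI gI fi gj ->]]]].
  exists (widen_ord (ltn_ord i) \o f), (widen_ord (ltn_ord j) \o g).
  by split=> // [x|x|]; [apply: leq_ord (f x) | apply: leq_ord (g x) |
     congr (\det _); apply/matrixP=> x y; rewrite !mxE].
exists (fun x => Ordinal (fi x : (f x < i.+1)%N)).
exists (fun x => Ordinal (gj x : (g x < j.+1)%N)); split=> //.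
by congr (\det _); apply/matrixP=> x y; rewrite !mxE; congr (A _ _); apply: val_inj.
Qed.

(** The rank function with strict bounds in [nat], so that blocks without rows or columns are
    allowed in inductions; [rank_fun w i j] is [rank_lt w i.+1 j.+1]. *)
Definition rank_lt (n : nat) (w : 'S_n) (a b : nat) : nat :=
  #|[set l : 'I_n | (l < a)%N && (w l < b)%N]|.

Lemma rank_ltSl (n : nat) (w : 'S_n) (i : 'I_n) (b : nat) :
  (w i < b)%N -> rank_lt w i.+1 b = (rank_lt w i b).+1.
Proof.
move=> wib; rewrite /rank_lt (cardsD1 i) inE ltnSn wib /= add1n; congr _.+1.
apply: eq_card => l; rewrite !inE ltnS andbA; congr (_ && _).
by rewrite -val_eqE /= ltn_neqAle.
Qed.

Lemma rank_ltSr (n : nat) (w : 'S_n) (a : nat) (j : 'I_n) :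
  ((w^-1)%g j < a)%N -> rank_lt w a j.+1 = (rank_lt w a j).+1.
Proof.
move=> wja; rewrite /rank_lt (cardsD1 ((w^-1)%g j)) inE wja permKV ltnSn /= add1n.
congr _.+1; apply: eq_card => l; rewrite !inE ltnS andbCA; congr (_ && _).
rewrite -(can_eq (permK w)) permKV -val_eqE /=.
by rewrite [RHS]ltn_neqAle.
Qed.

Definition minors_in (R : comNzRingType) (n : nat) (A : 'M[R]_n)
    (J : R -> Prop) (a b s : nat) : Prop :=
  forall f g : 'I_s -> 'I_n,
    {homo f : x y / (x < y)%N} -> {homo g : x y / (x < y)%N} ->
    (forall x, (f x < a)%N) -> (forall x, (g x < b)%N) ->
  J (\det (mxsub f g A)).

Lemma minors_in_tr (R : comNzRingType) (n : nat) (A : 'M[R]_n)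
    (J : R -> Prop) (a b s : nat) :
  minors_in A^T J b a s -> minors_in A J a b s.
Proof.
by move=> JT f g fI gI fa gb; rewrite -det_tr trmx_mxsub; apply: JT.
Qed.

(** Expand along the last chosen row: the other chosen rows lie strictly above it, hence among the
    first [a]. *)
Lemma minors_in_row (R : comNzRingType) (n : nat) (A : 'M[R]_n)
    (G : R -> Prop) (a b s : nat) :
  minors_in A (ideal_gen G) a b s -> minors_in A (ideal_gen G) a.+1 b s.+1.
Proof.
move=> IH f g fI gI fa gb; rewrite (expand_det_row _ ord_max).
apply: ideal_gen_sum => y; rewrite /cofactor; do 2!apply: ideal_genM.
rewrite (_ : row' _ _ = mxsub (f \o lift ord_max) (g \o lift y) A); last first.
  by apply/matrixP=> p q; rewrite !mxE.
apply: IH => [p q pq|p q pq|p|p] /=.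
- by apply: fI; rewrite !lift_max.
- by apply: gI; rewrite /= /bump; lia.
- have : (f (lift ord_max p) < f ord_max)%N.
    by apply: fI; rewrite lift_max /=.
  by have := fa ord_max; lia.
exact: gb.
Qed.

Lemma minors_in_col (R : comNzRingType) (n : nat) (A : 'M[R]_n)
    (G : R -> Prop) (a b s : nat) :
  minors_in A (ideal_gen G) a b s -> minors_in A (ideal_gen G) a b.+1 s.+1.
Proof.
move=> IH; apply: minors_in_tr; apply: minors_in_row; apply: minors_in_tr.
by rewrite trmxK.
Qed.

Lemma minors_in_up (R : comNzRingType) (n : nat) (A : 'M[R]_n)
    (G : R -> Prop) (a b s : nat) :
  minors_in A (ideal_gen G) a b s -> minors_in A (ideal_gen G) a b s.+1.
Proof.
by move=> /minors_in_row IH f g fI gI fa gb; apply: (IH f g) => // x; apply: ltnW (fa x).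
Qed.

(* The 1 of row [i] (resp. column [j]) lies weakly northwest of [(i, j)] when
   this entry is outside the diagram of [w]; it is then dropped by expanding
   along the last row (resp. column). *)
Lemma minors_in_diagram (R : comNzRingType) (n : nat) (w : 'S_n)
    (A : 'M[R]_n) (G : R -> Prop) (a b s : nat) :
    (forall i j : 'I_n, (j < w i)%N -> (i < (w^-1)%g j)%N ->
       minors_in A (ideal_gen G) i.+1 j.+1 (rank_fun w i j).+1) ->
  (a <= n)%N -> (b <= n)%N -> (rank_lt w a b < s)%N ->
  minors_in A (ideal_gen G) a b s.
Proof.
move=> box; elim: s a b => // s IHs a.
elim: a => [|a IHa] b an bn rs.
  by move=> f g _ _ fa; have := fa ord0.
case: b bn rs => [|b] bn rs.
  by move=> f g _ _ _ gb; have := gb ord0.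
pose i := Ordinal an; pose j := Ordinal bn.
case: (ltnP j (w i)) => [jwi|wij]; last first.
  apply: minors_in_row; apply: IHs; [exact: ltnW | exact: bn |].
  by move: rs; rewrite (@rank_ltSl n w i).
case: (ltnP i ((w^-1)%g j)) => [iwj|wji]; last first.
  apply: minors_in_col; apply: IHs; [exact: an | exact: ltnW |].
  by move: rs; rewrite (@rank_ltSr n w _ j).
(* At a box, a minor of size rank + 1 is covered by [box]; a larger one expands into smaller minors
   still exceeding the rank. *)
move: rs; rewrite ltnS leq_eqVlt => /orP[/eqP <-|rs].
  exact: (box i j).
by apply/minors_in_up/IHs.
Qed.

(** * Binomial generators when all boxes have rank at most 1 *)

Lemma det_mx22 (R : comNzRingType) (M : 'M[R]_2) :
  \det M = M ord0 ord0 * M ord_max ord_max - M ord0 ord_max * M ord_max ord0.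
Proof.
have -> : ord_max = lift ord0 ord0 :> 'I_2 by apply: val_inj.
rewrite (expand_det_row _ ord0) 2!big_ord_recl big_ord0 addr0 /cofactor.
rewrite !det_mx11 !mxE /= expr0 expr1 mul1r mulN1r mulrN.
by congr (_ * M _ _ - _ * M _ _); apply: val_inj.
Qed.

Lemma is_binomialBX (k : fieldType) (m : nat) (u v : 'X_{1..m}) :
  is_binomial ('X_[u] - 'X_[v] : {mpoly k[m]}).
Proof.
apply: (@uniq_leq_size _ _ [:: u; v]); first exact: msupp_uniq.
by move=> x /msuppD_le; rewrite mem_cat (perm_mem (msuppN _)) !msuppX !inE.
Qed.

Lemma generic_minor_binomial (k : fieldType) (n s : nat) (f g : 'I_s -> 'I_n) :
  (s <= 2)%N -> is_binomial (\det (mxsub f g (generic_mx k n))).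
Proof.
case: s f g => [|[|[|s]]] f g // _.
- by rewrite det_mx00 /is_binomial msupp1.
- by rewrite det_mx11 !mxE /is_binomial msuppX.
by rewrite det_mx22 !mxE -!mpolyXD; apply: is_binomialBX.
Qed.

Lemma schubert_ideal_binomial (k : fieldType) (n : nat) (w : 'S_n) :
  (forall i j : 'I_n, (j < w i)%N -> (i < (w^-1)%g j)%N ->
     (rank_fun w i j <= 1)%N) ->
  binomial_ideal (schubert_ideal k w).
Proof.
move=> box.
(* The generators kept are the defining minors that are binomials; those of the boxes are among them
   and suffice. *)
exists (fun p => is_binomial p /\ exists i j : 'I_n,
    is_minor (rank_fun w i j).+1 (nw_submx (generic_mx k n) i j) p).
  by move=> b [].
move=> p; split; apply: ideal_gen_min => g; last first.
  by case=> _ ?; apply: ideal_gen_sub.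
case=> i [j /is_minor_nwP[f [h [fI hI fi hj ->]]]].
apply: (@minors_in_diagram _ _ w _ _ i.+1 j.+1 (rank_fun w i j).+1) => //.
move=> i' j' jwi iwj f' h' fI' hI' fi' hj'.
apply: ideal_gen_sub; split; first exact/generic_minor_binomial/box.
by exists i', j'; apply/is_minor_nwP; exists f', h'.
Qed.

(** * Evaluation at points of the matrix Schubert variety *)

Lemma increasing_enum (n s : nat) (S : {set 'I_n}) : #|S| = s ->
  exists f : 'I_s -> 'I_n, [/\ {homo f : x y / (x < y)%N},
    forall a, f a \in S & forall x, x \in S -> exists a, f a = x].
Proof.
move=> <-; exists enum_val; split=> [a b ab|a|x xS].
- have n0 : 'I_n by apply: enum_val a.
  have srt : sorted (fun x y : 'I_n => (x < y)%N) (enum S).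
    rewrite {1}/enum_mem; apply: sorted_filter; first by move=> ? ? ?; apply: ltn_trans.
    have := iota_ltn_sorted 0 n; rewrite -val_enum_ord sorted_map.
    by rewrite enumT.
  rewrite !(enum_val_nth n0); apply: (sorted_ltn_nth _ n0 srt) => //.
  + by move=> ? ? ?; apply: ltn_trans.
  + by rewrite inE -cardE.
  + by rewrite inE -cardE.
- exact: enum_valP.
by exists (enum_rank_in xS x); rewrite enum_rankK_in.
Qed.

Lemma homo_ltn_inj (n s : nat) (f : 'I_s -> 'I_n) :
  {homo f : x y / (x < y)%N} -> injective f.
Proof.
move=> fI a b E; case: (ltngtP a b) => [/fI|/fI|/val_inj//];
  by rewrite E ltnn.
Qed.

Definition mx_eval (k : fieldType) (n : nat) (A : 'M[k]_n)
    (p : {mpoly k[n * n]}) : k :=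
  p.@[fun t => mxvec A 0 t].

Lemma mx_eval_minor (k : fieldType) (n s : nat) (A : 'M[k]_n)
    (f g : 'I_s -> 'I_n) :
  mx_eval A (\det (mxsub f g (generic_mx k n))) = \det (mxsub f g A).
Proof.
rewrite /mx_eval -det_map_mx; congr (\det _); apply/matrixP=> x y.
by rewrite !mxE /= mevalXU mxvecE.
Qed.

Lemma mx_eval_monomial (k : fieldType) (n s : nat) (A : 'M[k]_n)
    (f g : 'I_s -> 'I_n) :
  mx_eval A 'X_[(\sum_a U_(mxvec_index (f a) (g a)))%MM] = \prod_a A (f a) (g a).
Proof.
rewrite /mx_eval -mprodXE rmorph_prod /=.
by apply: eq_bigr => a _; rewrite mevalXU mxvecE.
Qed.

(* Downward row operations and rightward column operations do not increase the
   ranks of northwest submatrices. *)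
Lemma schubert_ideal_vanish (k : fieldType) (n : nat) (w : 'S_n)
    (L U : 'M[k]_n) (p : {mpoly k[n * n]}) :
    (forall x y : 'I_n, (x < y)%N -> L x y = 0) ->
    (forall x y : 'I_n, (y < x)%N -> U x y = 0) ->
  schubert_ideal k w p -> mx_eval (L *m row_perm w U) p = 0.
Proof.
move=> L0 U0 [s Gs ->]; rewrite /mx_eval rmorph_sum big_seq big1 //= => t ts.
suff t0 : mx_eval (L *m row_perm w U) t.2 = 0.
  by rewrite rmorphM /= [X in _ * X]t0 mulr0.
have [i [j /is_minor_nwP[f [g [fI gI fi gj ->]]]]] := Gs t ts.
rewrite mx_eval_minor.
set S := [set l : 'I_n | (l <= i)%N && (w l <= j)%N].
pose P : 'M[k]_(_, #|S|) := \matrix_(x, a) L (f x) (enum_val a).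
pose Q : 'M[k]_(#|S|, _) := \matrix_(a, y) U (w (enum_val a)) (g y).
(* Triangularity kills the summands outside [S], so the block factors through dimension [#|S|], one
   less than the size of the minor. *)
have -> : mxsub f g (L *m row_perm w U) = P *m Q.
  apply/matrixP=> x y; rewrite !mxE; under [RHS]eq_bigr => a _ do rewrite !mxE.
  rewrite -(big_enum_val (fun l => L (f x) l * U (w l) (g y))) /=.
  rewrite (bigID (mem S)) /= [X in _ + X]big1 ?addr0 => [|l].
    by apply: eq_bigr => l _; rewrite mxE.
  rewrite inE negb_and -!ltnNge mxE => /orP[il|jl].
    by rewrite L0 ?mul0r // (leq_ltn_trans (fi x)).
  by rewrite U0 ?mulr0 // (leq_ltn_trans (gj y)).
apply/eqP/negPn/negP => det0.
have /eqP rN : \rank (P *m Q) == (rank_fun w i j).+1.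
  by rewrite -/(row_free _) row_free_unit unitmxE unitfE.
by have := mulmx_max_rank P Q; rewrite rN ltnn.
Qed.

(** [row_perm w U] is the product of the permutation matrix of [w] with [U], so the right factor
    acts as a column operation. *)
Definition sheared_perm_mx (k : fieldType) (n : nat) (w : 'S_n)
    (q i j : 'I_n) : 'M[k]_n :=
  (1%:M + delta_mx i q) *m row_perm w (1%:M + delta_mx (w q) j).

Lemma sheared_perm_mxE (k : fieldType) (n : nat) (w : 'S_n)
    (q i j x y : 'I_n) :
  sheared_perm_mx k w q i j x y =
    ((w x == y)%:R + ((x == q) && (y == j))%:R) +
    (x == i)%:R * ((w q == y)%:R + (y == j)%:R).
Proof.
rewrite /sheared_perm_mx mulmxDl mul1mx mxE !mxE (inj_eq perm_inj).
congr (_ + _).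
rewrite (bigD1 q) //= big1 ?addr0 => [|l lq].
  by rewrite !mxE eqxx andbT eqxx.
by rewrite !mxE (negbTE lq) andbF mul0r.
Qed.

Lemma sheared_perm_mx_vanish (k : fieldType) (n : nat) (w : 'S_n)
    (q i j : 'I_n) (p : {mpoly k[n * n]}) :
  (q < i)%N -> (w q < j)%N -> schubert_ideal k w p ->
  mx_eval (sheared_perm_mx k w q i j) p = 0.
Proof.
move=> qi wqj; apply: schubert_ideal_vanish => x y xy; rewrite !mxE.
  rewrite -val_eqE (ltn_eqF xy) add0r; case: eqP => //= xi.
  by rewrite -val_eqE gtn_eqF //= (ltn_trans qi) // -xi.
rewrite -val_eqE (gtn_eqF xy) add0r andbC; case: eqP => //= yj.
by rewrite -val_eqE gtn_eqF //= (ltn_trans wqj) // -yj.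
Qed.

(** * A diagram box with two 1s strictly northwest of it *)

Section HighRankBox.

Variables (n : nat) (w : 'S_n) (i j q1 q2 : 'I_n).
Hypotheses (jwi : (j < w i)%N) (iwj : (i < (w^-1)%g j)%N).
Hypotheses (q12 : q1 != q2) (q1i : (q1 < i)%N) (q2i : (q2 < i)%N).
Hypotheses (wq1j : (w q1 < j)%N) (wq2j : (w q2 < j)%N).

Let nw_rows : {set 'I_n} := [set l : 'I_n | (l <= i)%N && (w l <= j)%N].

Let box_rows := i |: nw_rows.

(** The column used in row [x] by the distinguished term of the minor. *)
Let box_col (x : 'I_n) : 'I_n := if x == i then j else w x.

Let wj_neq (x : 'I_n) : (x <= i)%N -> (w x == j) = false.
Proof.
move=> xi; apply/negP=> /eqP wx; move: iwj.
by rewrite -wx permK ltnNge xi.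
Qed.

Let box_rows_le (x : 'I_n) : x \in box_rows -> (x <= i)%N.
Proof. by rewrite !inE => /orP[/eqP->//|/andP[]]. Qed.

Let box_col_le (x : 'I_n) : x \in box_rows -> (box_col x <= j)%N.
Proof. by rewrite !inE /box_col; case: eqP => //= _ /andP[]. Qed.

Let box_col_inj : {in box_rows &, injective box_col}.
Proof.
move=> x y xS yS; rewrite /box_col.
case: (eqVneq x i) => [->|xi]; case: (eqVneq y i) => [->|yi] // E.
- by move: (wj_neq (box_rows_le yS)); rewrite -E eqxx.
- by move: (wj_neq (box_rows_le xS)); rewrite E eqxx.
exact: perm_inj E.
Qed.

Let box_sheared (k : fieldType) (q x : 'I_n) :
  (q < i)%N -> (w q < j)%N -> x \in box_rows ->
  sheared_perm_mx k w q i j x (box_col x) = 1.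
Proof.
move=> qi wqj xS; rewrite sheared_perm_mxE /box_col.
have wqNj : (w q == j) = false by rewrite -val_eqE ltn_eqF.
case: (eqVneq x i) => [->|xi].
  rewrite wqNj eqxx !mul1r -!val_eqE /= (gtn_eqF jwi) (gtn_eqF qi).
  by rewrite /= !add0r.
by rewrite eqxx (wj_neq (box_rows_le xS)) andbF mul0r !addr0.
Qed.

(** The shear by [q] adds entries only at [(q, j)], [(i, w q)] and [(i, j)]. As [q1] and [q2]
    differ, the two shears share only [(i, j)]; the 1 of row [i] lies to the right of column [j]. *)
Let box_sheared_supp (k : fieldType) (x y : 'I_n) :
    x \in box_rows -> (y <= j)%N ->
    sheared_perm_mx k w q1 i j x y != 0 ->
    sheared_perm_mx k w q2 i j x y != 0 ->
  y = box_col x.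
Proof.
move=> xS yj; rewrite !sheared_perm_mxE /box_col.
case: (eqVneq x i) => [->|xi].
  have -> : (w i == y) = false by rewrite -val_eqE gtn_eqF // (leq_ltn_trans yj).
  case: (eqVneq y j) => // _; rewrite !andbF !add0r !mul1r !addr0.
  case: (eqVneq (w q1) y) => [<-|]; last by rewrite eqxx.
  by rewrite (inj_eq perm_inj) [q2 == _]eq_sym (negbTE q12) eqxx.
rewrite !mul0r !addr0; case: (eqVneq (w x) y) => // _; rewrite !add0r.
case: (eqVneq x q1) => [->|]; last by rewrite eqxx.
by rewrite (negbTE q12) eqxx.
Qed.

Lemma schubert_ideal_not_binomial (k : fieldType) :
  ~ binomial_ideal (schubert_ideal k w).
Proof.
move=> binI; pose s := (rank_fun w i j).+1.
have cS : #|box_rows| = s.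
  by rewrite /box_rows cardsU1 inE leqnn /= leqNgt jwi.
have [f [fI fS fsurj]] := increasing_enum cS.
have cT : #|box_col @: box_rows| = s by rewrite card_in_imset.
have [g [gI gT gsurj]] := increasing_enum cT.
have finj := homo_ltn_inj fI; have ginj := homo_ltn_inj gI.
have gj a : (g a <= j)%N.
  by have /imsetP[x xS ->] := gT a; apply: box_col_le.
(* [h] matches positions of rows with positions of columns, so it is the permutation indexing the
   distinguished term in the Leibniz expansion. *)
have [h hE] : exists h : 'I_s -> 'I_s, forall a, g (h a) = box_col (f a).
  apply: (fin_all_exists (P := fun a b => g b = box_col (f a))) => a.
  exact/gsurj/imset_f.
have hinj : injective h.
  by move=> a b /(congr1 g); rewrite !hE => /box_col_inj E; apply/finj/E.
pose sg0 := perm hinj.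
pose M (sg : 'S_s) := (\sum_a U_(mxvec_index (f a) (g (sg a))))%MM.
have evM q sg : mx_eval (sheared_perm_mx k w q i j) 'X_[M sg] =
    \prod_a sheared_perm_mx k w q i j (f a) (g (sg a)).
  exact: (mx_eval_monomial _ f (g \o sg)).
have ev0 (q : 'I_n) : (q < i)%N -> (w q < j)%N ->
    mx_eval (sheared_perm_mx k w q i j) 'X_[M sg0] = 1.
  move=> qi wqj; rewrite evM big1 // => a _.
  by rewrite permE hE box_sheared.
have [||//|sg sgN [c c0 cong]] :=
    binomial_ideal_monomials (c := fun sg : 'S_s => (-1) ^+ sg) (M := M)
      (t0 := sg0) binI.
- apply: ideal_gen_sub; exists i, j; apply/is_minor_nwP; exists f, g.
  split=> // [a|]; first exact: box_rows_le.
  apply: eq_bigr => sg _; rewrite /M -mprodXE -mul_mpolyC rmorphXn rmorphN1.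
  by congr (_ * _); apply: eq_bigr => a _; rewrite !mxE.
- by rewrite signr_eq0.
- move=> I0; have := sheared_perm_mx_vanish q1i wq1j I0.
  by rewrite ev0 // => /eqP; rewrite oner_eq0.
(* At the sheared point [cong] gives the monomial of [sg] the value [c], which is nonzero, so none
   of its factors vanishes. *)
have nz (q : 'I_n) : (q < i)%N -> (w q < j)%N ->
    forall a, sheared_perm_mx k w q i j (f a) (g (sg a)) != 0.
  move=> qi wqj a; have := sheared_perm_mx_vanish qi wqj cong.
  rewrite /mx_eval mevalB mevalZ -!/(mx_eval _ _) ev0 // mulr1 evM.
  move/eqP; rewrite subr_eq0 => /eqP E; move: c0; rewrite -E.
  by move/prodf_neq0/(_ a); apply.
case/eqP: sgN; apply/permP=> a; apply: ginj.
rewrite permE hE; apply: box_sheared_supp => //; exact: nz.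
Qed.

End HighRankBox.

(** * From diagram boxes to patterns *)

Lemma diagram_rank_gt1 (n : nat) (w : 'S_n) (i j : 'I_n) :
    (j < w i)%N -> (i < (w^-1)%g j)%N -> (1 < rank_fun w i j)%N ->
  exists q1 q2 : 'I_n, [/\ (q1 < q2)%N, (q2 < i)%N, (w q1 < j)%N & (w q2 < j)%N].
Proof.
move=> jwi iwj /card_gt1P[q1 [q2 []]].
rewrite !inE => /andP[q1i wq1] /andP[q2i wq2] q12.
(* The 1s in the row and the column of a box lie beyond it, so weakly northwest means strictly
   northwest here. *)
have lt (q : 'I_n) : (q <= i)%N -> (w q <= j)%N -> (q < i)%N && (w q < j)%N.
  move=> qi wq; rewrite !ltn_neqAle qi wq !andbT; apply/andP; split.
    by apply: contraTneq jwi => /val_inj <-; rewrite -leqNgt.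
  by apply: contraTneq iwj => /val_inj <-; rewrite permK -leqNgt.
have /andP[? ?] := lt q1 q1i wq1; have /andP[? ?] := lt q2 q2i wq2.
case: (ltngtP q1 q2) => [|| /val_inj E]; [by exists q1, q2 | by exists q2, q1 |].
by rewrite E eqxx in q12.
Qed.

Lemma contains_pattern4 (n : nat) (w : 'S_n) (v : 'S_4) (l : seq nat)
    (q1 q2 i e : 'I_n) :
    (forall a, (v a).+1 = nth 0%N l a) ->
    (q1 < q2)%N -> (q2 < i)%N -> (i < e)%N ->
    (forall a b : 'I_4, (w (nth i [:: q1; q2; i; e] a) <
       w (nth i [:: q1; q2; i; e] b))%N = (nth 0%N l a < nth 0%N l b)%N) ->
  contains_pattern w v.
Proof.
move=> vE q12 q2i ie wE; exists (fun a : 'I_4 => nth i [:: q1; q2; i; e] a).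
  by move=> [[|[|[|[|a]]]] //= ?] [[|[|[|[|b]]]] //= ?] //= _; lia.
by move=> a b; rewrite wE -!vE ltnS.
Qed.

(* 1243 and 2143 are the two patterns in which the entries 4 and 3 span a diagram
   box with two 1s of the permutation matrix northwest of it. *)
Lemma avoids_1243_2143P (n : nat) (w : 'S_n) :
  (avoids w perm1243 /\ avoids w perm2143) <->
  (forall i j : 'I_n, (j < w i)%N -> (i < (w^-1)%g j)%N ->
     (rank_fun w i j <= 1)%N).
Proof.
split=> [[no1243 no2143] i j jwi iwj|box].
  rewrite leqNgt; apply/negP => /(diagram_rank_gt1 jwi iwj)[q1 [q2 [q12 q2i wq1 wq2]]].
  (* Rows [i] and [e] play the entries 4 and 3; the order of [w q1] and [w q2] decides between the
     two patterns. *)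
  pose e := (w^-1)%g j; have we : w e = j by rewrite permKV.
  have ie : (i < e)%N by [].
  case: (ltngtP (w q1) (w q2)) => [lt|gt|/val_inj/perm_inj E].
  - case: no1243; apply: (contains_pattern4 perm1243_oneline q12 q2i ie).
    by move=> [[|[|[|[|a]]]] //= ?] [[|[|[|[|b]]]] //= ?] //=; rewrite ?we; lia.
  - case: no2143; apply: (contains_pattern4 perm2143_oneline q12 q2i ie).
    by move=> [[|[|[|[|a]]]] //= ?] [[|[|[|[|b]]]] //= ?] //=; rewrite ?we; lia.
  by move: q12; rewrite E ltnn.
(* The order of the first two values is left open, which treats both patterns at once. *)
have big (f : 'I_4 -> 'I_n) : {homo f : a b / (a < b)%N} ->
    (w (f (inord 0)) < w (f (inord 3)))%N ->
    (w (f (inord 1)) < w (f (inord 3)))%N ->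
    (w (f (inord 3)) < w (f (inord 2)))%N -> False.
  move=> fI w03 w13 w32.
  have f23 : (f (inord 2) < f (inord 3))%N by apply: fI; rewrite !inordK.
  have := box (f (inord 2)) (w (f (inord 3))) w32; rewrite permK => /(_ f23).
  rewrite leqNgt => /negP; apply; apply/card_gt1P.
  exists (f (inord 0)), (f (inord 1)); rewrite !inE (ltnW w03) (ltnW w13) !andbT.
  have f01 : (f (inord 0) < f (inord 1))%N by apply: fI; rewrite !inordK.
  have f12 : (f (inord 1) < f (inord 2))%N by apply: fI; rewrite !inordK.
  by split; [lia | lia | rewrite -val_eqE /= ltn_eqF].
by split=> -[f fI wE]; apply: (big f fI);
  rewrite wE -ltnS ?perm1243_oneline ?perm2143_oneline !inordK.
Qed.

Theorem theorem1p6 (k : fieldType) (n : nat) (w : 'S_n) :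
  binomial_ideal (schubert_ideal k w) <->
  avoids w perm1243 /\ avoids w perm2143.
Proof.
rewrite avoids_1243_2143P; split; last exact: schubert_ideal_binomial.
move=> binI i j jwi iwj; rewrite leqNgt; apply/negP.
case/(diagram_rank_gt1 jwi iwj) => q1 [q2 [q12 q2i wq1 wq2]].
have q12N : q1 != q2 by rewrite -val_eqE ltn_eqF.
exact: (schubert_ideal_not_binomial jwi iwj q12N (ltn_trans q12 q2i)) binI.
Qed.
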